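(* For a Raney extension $(L,C)$, the map \[ \sigma:(L,\mathcal{I}(C^*\cup \mathsf{Filt}_{\mathcal{CP}}(L))^{op})\to (L,C),\qquad F\mapsto \bigwedge F \] (the meet of $F\subseteq L\subseteq C$ being computed in $C$) is its sobrification.
   Context: A Raney extension is a pair $(L,C)$ where $C$ is a coframe, $L\subseteq C$ is a frame such that every element of $C$ is a meet of elements of $L$, and the inclusion preserves arbitrary joins, finite meets, and strongly exact meets of $L$. A meet $\bigwedge_i x_i$ in $L$ is strongly exact if for all $y\in L$, $x_i\to y=y$ for all $i$ implies $(\bigwedge_i x_i)\to y=y$. A morphism $f:(L,C)\to(M,D)$ of the category $\mathbf{Raney}$ is a coframe map $f:C\to D$ (preserving arbitrary meets and finite joins) with $f[L]\subseteq M$ whose restriction $L\to M$ is a frame map. For $c\in C$, $\uparrow^L c=\{a\in L:c\le a\}$, and $C^*=\{\uparrow^L c:c\in C\}$, a collection of filters of $L$. $\mathsf{Filt}_{\mathcal{CP}}(L)$ is the collection of completely prime filters of $L$ (filters $F$ such that $\bigvee_i x_i\in F$ implies $x_i\in F$ for some $i$). $\mathcal{I}(-)$ denotes closure under arbitrary set-theoretical intersections, including the empty one (the whole $L$). Collections of filters are ordered by inclusion, $(-)^{op}$ reverses the order, and each $a\in L$ is identified with its principal filter $\uparrow a$. A Raney extension $(L,C)$ is sober if it is $\mathcal{CP}$-compact: for every completely prime filter $F$ of $L$ and $a\in L$, if $\bigwedge F\le a$ (meet in $C$) then $a\in F$. A morphism $\sigma:S(L,C)\to(L,C)$ of $\mathbf{Raney}$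 is a sobrification of $(L,C)$ if $S(L,C)$ is a sober Raney extension and for every morphism $f:(M,D)\to(L,C)$ from a sober Raney extension there is a morphism $f_\sigma:(M,D)\to S(L,C)$ with $\sigma\circ f_\sigma=f$. *)

(* Defs.v *)
From HB Require Import structures.
From mathcomp Require Import all_boot all_order.
From mathcomp Require Import boolp classical_sets.

Set Implicit Arguments.
Unset Strict Implicit.
Unset Printing Implicit Defensive.

Import Order.TTheory.
Local Open Scope classical_set_scope.
Local Open Scope order_scope.

HB.mixin Record TBLattice_isComplete (d : Order.disp_t) T
    of Order.TBLattice d T := {
  bigjoin : set T -> T;
  bigmeet : set T -> T;
  bigjoinP : forall A : set T, supremums A (bigjoin A);
  bigmeetP : forall A : set T, infimums A (bigmeet A) }.

#[short(type="completeLatticeType")]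
HB.structure Definition CompleteLattice (d : Order.disp_t) :=
  { T of Order.TBLattice d T & TBLattice_isComplete d T }.

Arguments bigjoin {d s} A : rename.
Arguments bigmeet {d s} A : rename.

HB.factory Record POrder_isComplete (d : Order.disp_t) T
    of Order.POrder d T := {
  bigjoin : set T -> T;
  bigmeet : set T -> T;
  bigjoinP : forall A : set T, supremums A (bigjoin A);
  bigmeetP : forall A : set T, infimums A (bigmeet A) }.

HB.builders Context d T of POrder_isComplete d T.

Fact lexI (x y z : T) : (x <= bigmeet [set y; z]) = (x <= y) && (x <= z).
Proof.
have [lb glb] := bigmeetP [set y; z].
apply/idP/andP => [xm|[xy xz]].
  by split; apply: (le_trans xm); apply: lb; [left|right].
by apply: glb => t [->|->].
Qed.

Fact leUx (x y z : T) : (bigjoin [set x; y] <= z) = (x <= z) && (y <= z).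
Proof.
have [ub lub] := bigjoinP [set x; y].
apply/idP/andP => [jz|[xz yz]].
  by split; apply: le_trans jz; apply: ub; [left|right].
by apply: lub => t [->|->].
Qed.

HB.instance Definition _ :=
  Order.POrder_MeetJoin_isLattice.Build d T lexI leUx.

Fact le0x (x : T) : bigjoin set0 <= x.
Proof. by have [_] := bigjoinP set0; apply. Qed.

Fact lex1 (x : T) : x <= bigmeet set0.
Proof. by have [_] := bigmeetP set0; apply. Qed.

HB.instance Definition _ := Order.hasBottom.Build d T le0x.
HB.instance Definition _ := Order.hasTop.Build d T lex1.
HB.instance Definition _ := TBLattice_isComplete.Build d T bigjoinP bigmeetP.

HB.end.

Section DualComplete.
Context (d : Order.disp_t) (T : completeLatticeType d).

Fact dual_bigjoinP (A : set T^d) :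
  supremums A ((bigmeet (A : set T)) : T^d).
Proof.
by have [lb glb] := bigmeetP (A : set T); split=> x Hx; [exact: lb|exact: glb].
Qed.

Fact dual_bigmeetP (A : set T^d) :
  infimums A ((bigjoin (A : set T)) : T^d).
Proof.
by have [ub lub] := bigjoinP (A : set T); split=> x Hx; [exact: ub|exact: lub].
Qed.

HB.instance Definition _ :=
  TBLattice_isComplete.Build (Order.dual_display d) T^d
    dual_bigjoinP dual_bigmeetP.

End DualComplete.

Section FramesCoframes.
Context (d d' : Order.disp_t).

Definition frame (L : completeLatticeType d) : Prop :=
  forall (a : L) (A : set L),
    a `&` bigjoin A = bigjoin [set a `&` x | x in A].

Definition coframe (C : completeLatticeType d) : Prop :=
  forall (a : C) (A : set C),
    a `|` bigmeet A = bigmeet [set a `|` x | x in A].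

Record frame_map (L : completeLatticeType d) (M : completeLatticeType d')
    (f : L -> M) : Prop := {
  frame_map_join : forall A : set L, f (bigjoin A) = bigjoin (f @` A);
  frame_map_top : f \top = \top;
  frame_map_meet : {morph f : x y / x `&` y} }.

Record coframe_map (C : completeLatticeType d) (D : completeLatticeType d')
    (f : C -> D) : Prop := {
  coframe_map_meet : forall A : set C, f (bigmeet A) = bigmeet (f @` A);
  coframe_map_bot : f \bot = \bot;
  coframe_map_join : {morph f : x y / x `|` y} }.

End FramesCoframes.

Section Filters.
Context (d : Order.disp_t) (L : completeLatticeType d).

Definition impl (x y : L) : L := bigjoin [set z | z `&` x <= y].

Definition strongly_exact (A : set L) : Prop :=
  forall y : L, (forall x, A x -> impl x y = y) -> impl (bigmeet A) y = y.

(* The improper filter is allowed. *)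
Record lattice_filter (F : set L) : Prop := {
  filter_top : F \top;
  filter_meet : forall a b, F a -> F b -> F (a `&` b);
  filter_up : forall a b, a <= b -> F a -> F b }.

Definition completely_prime (F : set L) : Prop :=
  lattice_filter F /\
  forall A : set L, F (bigjoin A) -> exists2 x, A x & F x.

Definition principal_filter (a : L) : set L := [set b | a <= b].

End Filters.

(* The inclusion of [L] into [C] is rendered as an order embedding
   [e : L -> C], and the extension is denoted by [e]. *)

Record raney (dL dC : Order.disp_t) (L : completeLatticeType dL)
    (C : completeLatticeType dC) (e : L -> C) : Prop := {
  raney_frame : frame L;
  raney_coframe : coframe C;
  raney_mono : {mono e : a b / a <= b};
  raney_dense : forall c : C, exists A : set L, c = bigmeet (e @` A);
  raney_frame_map : frame_map e;
  raney_strongly_exact : forall A : set L, strongly_exact A ->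
    e (bigmeet A) = bigmeet (e @` A) }.

(* As [j] is injective, the frame map [g] below is the restriction of [f] to
   [L], which is then valued in [M]. *)
Definition raney_morphism (dL dC dM dD : Order.disp_t)
    (L : completeLatticeType dL) (C : completeLatticeType dC)
    (M : completeLatticeType dM) (D : completeLatticeType dD)
    (e : L -> C) (j : M -> D) (f : C -> D) : Prop :=
  coframe_map f /\
  exists2 g : L -> M, frame_map g & forall a, f (e a) = j (g a).

Definition sober (dL dC : Order.disp_t) (L : completeLatticeType dL)
    (C : completeLatticeType dC) (e : L -> C) : Prop :=
  forall (F : set L) (a : L),
    completely_prime F -> bigmeet (e @` F) <= e a -> F a.

(* [sobrification e i s]: the map [s] from the Raney extension [i] to the Raney
   extension [e] is a sobrification of [e]. *)
Definition sobrification (dL dC dK dS : Order.disp_t)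
    (L : completeLatticeType dL) (C : completeLatticeType dC)
    (K : completeLatticeType dK) (S : completeLatticeType dS)
    (e : L -> C) (i : K -> S) (s : S -> C) : Prop :=
  [/\ raney i, sober i, raney_morphism i e s &
    forall (dM dD : Order.disp_t) (M : completeLatticeType dM)
        (D : completeLatticeType dD) (j : M -> D) (f : D -> C),
      raney j -> sober j -> raney_morphism j e f ->
      exists2 f' : D -> S, raney_morphism j i f' & s \o f' = f].

(* Taking [H] empty puts [setT] in the closure. *)
Definition inter_closure (T : Type) (G : set (set T)) : set (set T) :=
  [set F | exists2 H, H `<=` G & F = \bigcap_(X in H) X].

(* The sets in [inter_closure G], ordered by inclusion. *)
Record closure_lattice (T : Type) (G : set (set T)) : Type := ClosureElement {
  closure_set :> set T;
  _ : closure_set \in inter_closure G }.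

Section ClosureLattice.
Context (T : Type) (G : set (set T)).
Local Notation I := (closure_lattice G).

HB.instance Definition _ := [isSub for @closure_set T G].
HB.instance Definition _ := [Choice of I by <:].
HB.instance Definition _ := [SubChoice_isSubPOrder of I by <: with set_display].

Fact bigcap_closed (A : set I) : \bigcap_(F in A) (F : set T) \in inter_closure G.
Proof.
apply/mem_set; exists [set X | G X /\ \bigcap_(F in A) (F : set T) `<=` X].
  by move=> X [].
apply/seteqP; split=> [x Ax X [_]|x Hx F AF]; first exact.
have /set_mem [H HG FE] := valP F; rewrite FE => X HX.
apply: Hx; split; first exact: HG.
by move=> y /(_ F AF); rewrite FE; apply.
Qed.

Definition closure_meet (A : set I) : I := ClosureElement (bigcap_closed A).

Fact closure_meetP (A : set I) : infimums A (closure_meet A).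
Proof.
split=> [F AF|F FA].
  by rewrite -Order.le_val SubK; apply/asboolP => x; apply.
rewrite -Order.le_val SubK; apply/asboolP => x Fx F' /FA.
by rewrite -Order.le_val => /asboolP; apply.
Qed.

Definition closure_join (A : set I) : I := closure_meet (ubound A).

Fact closure_joinP (A : set I) : supremums A (closure_join A).
Proof.
have [lb glb] := closure_meetP (ubound A).
by split=> // F AF; apply: glb => F'; apply.
Qed.

HB.instance Definition _ :=
  POrder_isComplete.Build set_display I closure_joinP closure_meetP.

End ClosureLattice.

Section Sobrification.
Context (dL dC : Order.disp_t).
Context (L : completeLatticeType dL) (C : completeLatticeType dC) (e : L -> C).

Definition upper_trace (c : C) : set L := [set a | c <= e a].

(* [range upper_trace] is $C^*$. *)
Definition sobr_generators : set (set L) :=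
  range upper_trace `|` [set F | completely_prime F].

Definition sobr_lattice := ((closure_lattice sobr_generators)^d)%type.

Definition sobr_filter (F : sobr_lattice) : set L :=
  closure_set (F : closure_lattice sobr_generators).

Definition sobr_map (F : sobr_lattice) : C := bigmeet (e @` sobr_filter F).

Hypothesis He : raney e.

Fact principal_in_closure (a : L) :
  principal_filter a \in inter_closure sobr_generators.
Proof.
apply/mem_set; exists [set principal_filter a].
  move=> _ ->; left; exists (e a) => //.
  by apply/seteqP; split=> b; rewrite /upper_trace /= (raney_mono He).
by rewrite bigcap_set1.
Qed.

Definition sobr_incl (a : L) : sobr_lattice :=
  ClosureElement (principal_in_closure a).

End Sobrification.

(* Main.v *)
Require Import Defs.
From mathcomp Require Import all_boot all_order.
From mathcomp Require Import boolp classical_sets.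

(** Everything comes down to the generators of the closure: upper traces of
    elements of [C] and completely prime filters of [L]. An element of the
    sobrification is an intersection of generators, so inclusion in it
    can be tested on the generators that contain it ([sobr_filter_sub]).

    The lattice [S] of these filters, with reverse inclusion, is a Raney
    extension of [L]. Its coframe law says that the closed filters form a frame
    under inclusion, as a sublocale of the frame of all filters: for a filter
    [F] and a generator [X], the Heyting implication from [F] to [X] is again
    closed. For the upper trace of [c] it is the upper trace of the
    co-Heyting difference of [c] and the meet of [F]
    ([residual_upper_trace]); for a completely prime [X] it is either [X] or the
    whole of [L] ([residual_completely_prime]). Strongly exact meets survive
    because both kinds of generators are closed under them
    ([completely_prime_strongly_exact]), and [S] is sober because completely
    prime filters are themselves closed.

    The map taking a filter to its meet in [C] preserves meets since all upper
    traces are closed, and finite joins since [C] is a coframe.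

    For the lifting property, let [f] be a morphism from a sober [(M, D)] to
    [(L, C)], restricting to [g : M -> L]. The only candidate for a lift sends
    [d] to the meet in [S] of the [g m], for [m] above [d]. It preserves meets
    because the preimage under [g] of each generator is an upper trace in [M]
    ([generator_preimage]): for the upper trace of [c] the left adjoint of [f]
    supplies the trace, and for a completely prime filter, whose preimage is
    completely prime, sobriety of [(M, D)] does. *)

Set Implicit Arguments.
Unset Strict Implicit.
Unset Printing Implicit Defensive.

Import Order.TTheory.
Local Open Scope classical_set_scope.
Local Open Scope order_scope.

(** * Complete lattices, frame maps and completely prime filters *)

Section CompleteLattices.
Context (d : Order.disp_t) (T : completeLatticeType d).
Implicit Types (x y : T) (A B : set T).

Lemma bigmeet_lb A x : A x -> bigmeet A <= x.
Proof. by have [lb _] := bigmeetP A; apply: lb. Qed.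

Lemma le_bigmeet A y : (forall x, A x -> y <= x) -> y <= bigmeet A.
Proof. by move=> yA; have [_] := bigmeetP A; apply. Qed.

Lemma bigjoin_ub A x : A x -> x <= bigjoin A.
Proof. by have [ub _] := bigjoinP A; apply: ub. Qed.

Lemma bigjoin_le A y : (forall x, A x -> x <= y) -> bigjoin A <= y.
Proof. by move=> yA; have [_] := bigjoinP A; apply. Qed.

Lemma bigjoin0 : bigjoin set0 = \bot :> T.
Proof. by apply/le_anti; rewrite le0x bigjoin_le. Qed.

Lemma bigjoin2 x y : bigjoin [set x; y] = x `|` y.
Proof.
apply/le_anti; rewrite leUx !bigjoin_ub ?andbT; [|by right|by left].
by apply: bigjoin_le => _ [->|->]; rewrite ?leUl ?leUr.
Qed.

Lemma coframe_join_bigmeets A B : coframe T ->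
  bigmeet A `|` bigmeet B =
  bigmeet [set z | exists x y, [/\ A x, B y & z = x `|` y]].
Proof.
move=> cofT; apply/le_anti/andP; split.
  by apply: le_bigmeet => _ [x [y [Ax By ->]]]; apply: leU2; apply: bigmeet_lb.
rewrite cofT; apply: le_bigmeet => _ [y By <-].
rewrite joinC cofT; apply: le_bigmeet => _ [x Ax <-].
by rewrite joinC; apply: bigmeet_lb; exists x, y.
Qed.

End CompleteLattices.

Section FrameMaps.
Context (dL dM : Order.disp_t).
Context (L : completeLatticeType dL) (M : completeLatticeType dM).
Context (g : L -> M) (fg : frame_map g).

Lemma frame_map_joinU : {morph g : x y / x `|` y}.
Proof. by move=> x y; rewrite -!bigjoin2 (frame_map_join fg) image_setU !image_set1. Qed.

Lemma frame_map_bot : g \bot = \bot.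
Proof. by rewrite -bigjoin0 (frame_map_join fg) image_set0 bigjoin0. Qed.

Lemma frame_map_le x y : x <= y -> g x <= g y.
Proof. by move=> /meet_idPl <-; rewrite (frame_map_meet fg) leIr. Qed.

Lemma completely_prime_preimage (F : set M) :
  completely_prime F -> completely_prime (g @^-1` F).
Proof.
move=> [[F1 FI Fup] Fcp]; split; first split; rewrite /preimage /=.
- by rewrite (frame_map_top fg).
- by move=> a b Fa Fb; rewrite (frame_map_meet fg); apply: FI.
- by move=> a b /frame_map_le; apply: Fup.
by move=> A; rewrite (frame_map_join fg) => /Fcp [_ [x Ax <-] Fx]; exists x.
Qed.

End FrameMaps.

Section CompletelyPrime.
Context (d : Order.disp_t) (L : completeLatticeType d).

Lemma completely_prime_join (F : set L) a b :
  completely_prime F -> F (a `|` b) -> F a \/ F b.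
Proof.
move=> [_ Fcp]; rewrite -bigjoin2 => /Fcp [_ [->|->]]; first by left.
by right.
Qed.

(** The join [p] of the complement of [F] is the largest element outside [F],
    and [x -> p] equals [p] as soon as [x] is in [F]. A strongly exact meet of
    elements of [F] therefore has the same property, which would make [p] the
    top element if that meet lay below [p]. *)
Lemma completely_prime_strongly_exact (F A : set L) :
  completely_prime F -> strongly_exact A -> A `<=` F -> F (bigmeet A).
Proof.
move=> [[F1 FI Fup] Fcp] seA AF.
pose p := bigjoin (~` F).
have Fp : ~ F p by move=> /Fcp [x].
have NFp x : ~ F x -> x <= p by move=> Fx; apply: bigjoin_ub.
apply: contrapT => /NFp Ap.
have/seA pE : forall x, A x -> impl x p = p.
  move=> x Ax; apply/le_anti/andP; split.
    apply: bigjoin_le => z /= zxp; apply: NFp => Fz.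
    by apply: Fp; apply: Fup zxp _; apply: FI => //; apply: AF.
  by apply: bigjoin_ub; rewrite /= leIl.
apply: Fp; apply: Fup F1; rewrite -pE; apply: bigjoin_ub.
by rewrite /= meet1x.
Qed.

End CompletelyPrime.

(** * Upper traces in a Raney extension *)

Section RaneyExtensions.
Context (dL dC : Order.disp_t).
Context (L : completeLatticeType dL) (C : completeLatticeType dC) (e : L -> C).
Hypothesis He : raney e.

Lemma bigmeet_upper_trace c : bigmeet (e @` upper_trace e c) = c.
Proof.
apply/le_anti/andP; split; last by apply: le_bigmeet => _ [a ca <-].
have [A cE] := raney_dense He c.
rewrite {2}cE; apply: le_bigmeet => _ [a Aa <-]; apply: bigmeet_lb.
by exists a => //; rewrite /upper_trace /= cE; apply: bigmeet_lb; exists a.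
Qed.

Lemma upper_trace_filter c : lattice_filter (upper_trace e c).
Proof.
have fe := raney_frame_map He.
split; rewrite /upper_trace /=.
- by rewrite (frame_map_top fe) lex1.
- by move=> a b ca cb; rewrite (frame_map_meet fe) lexI ca.
- by move=> a b ab ca; apply: le_trans ca _; rewrite (raney_mono He).
Qed.

End RaneyExtensions.

(** * The sobrification as a sober Raney extension *)

Section Sobrification.
Context (dL dC : Order.disp_t).
Context (L : completeLatticeType dL) (C : completeLatticeType dC) (e : L -> C).
Hypothesis He : raney e.

Local Notation G := (sobr_generators e).
Local Notation S := (sobr_lattice e).

Lemma generator_filter X : G X -> lattice_filter X.
Proof. by case=> [[c _ <-]|[]//]; apply: (upper_trace_filter He). Qed.

Lemma inter_closure_generator X : G X -> inter_closure G X.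
Proof. by move=> GX; exists [set X]; [move=> _ ->|rewrite bigcap_set1]. Qed.

Lemma inter_closureT : inter_closure G setT.
Proof. by exists set0; [|rewrite bigcap_set0]. Qed.

Lemma sobr_leP (F F' : S) :
  reflect (sobr_filter F' `<=` sobr_filter F) (F <= F').
Proof.
change (reflect (sobr_filter F' `<=` sobr_filter F)
  ((F' : closure_lattice G) <= (F : closure_lattice G))).
by rewrite -Order.le_val; apply: asboolP.
Qed.

Lemma sobr_filterP (F : S) : inter_closure G (sobr_filter F).
Proof. exact: set_mem (valP (F : closure_lattice G)). Qed.

Lemma sobr_filter_sub (F : S) (A : set L) :
  (forall X, G X -> sobr_filter F `<=` X -> A `<=` X) -> A `<=` sobr_filter F.
Proof.
move=> AX a Aa; have [H HG FE] := sobr_filterP F; rewrite FE => X HX.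
by apply: AX Aa; [exact: HG|rewrite FE => b; apply].
Qed.

Lemma sobr_filter_filter (F : S) : lattice_filter (sobr_filter F).
Proof.
have [H HG ->] := sobr_filterP F; split.
- by move=> X /HG/generator_filter/filter_top.
- move=> a b Ha Hb X HX; have fX := generator_filter (HG _ HX).
  exact: filter_meet (Ha X HX) (Hb X HX).
- move=> a b ab Ha X HX; have fX := generator_filter (HG _ HX).
  exact: filter_up ab (Ha X HX).
Qed.

(** Meets in the reversed order are closures of unions, so a closed set
    contains the meet as soon as it contains every member of the family. *)
Lemma sobr_filter_meet (A : set S) (Y : set L) : inter_closure G Y ->
  (forall F, A F -> sobr_filter F `<=` Y) -> sobr_filter (bigmeet A) `<=` Y.
Proof.
move=> IY AY.
pose Y' : S := ClosureElement (mem_set IY).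
by apply/(sobr_leP Y')/le_bigmeet => F /AY /(sobr_leP Y').
Qed.

Lemma sobr_filter_bigjoin (A : set S) :
  sobr_filter (bigjoin A) = \bigcap_(F in A) sobr_filter F.
Proof.
apply/seteqP; split=> [a aA F AF|].
  by have /sobr_leP := bigjoin_ub AF; apply.
pose B : S := ClosureElement (bigcap_closed (A : set (closure_lattice G))).
by apply/(sobr_leP _ B)/bigjoin_le => F AF; apply/(sobr_leP _ B) => a; apply.
Qed.

Lemma sobr_filter_join (F F' : S) :
  sobr_filter (F `|` F') = sobr_filter F `&` sobr_filter F'.
Proof. by rewrite -bigjoin2 sobr_filter_bigjoin bigcap_setU !bigcap_set1. Qed.

Lemma sobr_inclP a (F : S) :
  reflect (sobr_filter F a) (F <= sobr_incl He a).
Proof.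
apply: (iffP (sobr_leP _ _)) => [|Fa b ab]; first by apply; exact: lexx.
exact: (filter_up (sobr_filter_filter F) (ab : a <= b) Fa).
Qed.

(** For upward closed [F] and [X] this is the Heyting implication from [F] to
    [X] among upward closed sets: [A] is included in it exactly when the
    intersection of [A] and [F] is included in [X]. *)
Definition residual (F X : set L) : set L :=
  [set a | forall x, F x -> X (a `|` x)].

(** As [C] is a coframe, [c <= e a `|` w] amounts to [b <= e a] for the
    co-Heyting difference [b] of [c] and [w]; here [w] is the meet of [F], and
    [c <= e a `|` w] amounts to [c <= e a `|` e x] for all [x] in [F]. *)
Lemma residual_upper_trace F c : inter_closure G (residual F (upper_trace e c)).
Proof.
have cofC := raney_coframe He.
have fe := raney_frame_map He.
pose b := bigmeet [set z | c <= z `|` bigmeet (e @` F)].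
have -> : residual F (upper_trace e c) = upper_trace e b.
  apply/seteqP; split=> a; rewrite /residual /upper_trace /= => Ha.
    apply: bigmeet_lb; rewrite /= cofC; apply: le_bigmeet => _ [_ [x Fx <-] <-].
    by rewrite -(frame_map_joinU fe); apply: Ha.
  have cb : c <= b `|` bigmeet (e @` F).
    rewrite joinC cofC; apply: le_bigmeet => _ [z cz <-].
    by rewrite joinC.
  move=> x Fx; apply: le_trans cb _; rewrite (frame_map_joinU fe).
  by apply: leU2 => //; apply: bigmeet_lb; exists x.
by apply: inter_closure_generator; left; exists b.
Qed.

(** If [F] is not contained in [X], some [x] in [F] lies outside [X], and
    primeness of [X] forces [a] into [X] whenever [a `|` x] is. *)
Lemma residual_completely_prime F X :
  completely_prime X -> inter_closure G (residual F X).
Proof.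
move=> cpX; have fX := cpX.1.
have [FX|/existsNP[x /not_implyP[Fx nXx]]] := pselect (F `<=` X).
  have -> : residual F X = setT; last exact: inter_closureT.
  by apply/seteqP; split=> // a _ x /FX; apply: (filter_up fX); rewrite leUr.
have -> : residual F X = X; last by apply: inter_closure_generator; right.
apply/seteqP; split=> [a /(_ x Fx)|a Xa y Fy].
  by move=> /(completely_prime_join cpX)[].
by apply: (filter_up fX) Xa; rewrite leUl.
Qed.

Lemma sobr_coframe : coframe S.
Proof.
move=> F A; apply/le_anti/andP; split.
  by apply: le_bigmeet => _ [F' AF' <-]; apply: leU2 => //; apply: bigmeet_lb.
(* If [X] contains each [sobr_filter F `&` sobr_filter F'], then the residual
   of [sobr_filter F] and [X] contains each [sobr_filter F'], hence the closure
   of their union. *)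
apply/sobr_leP; rewrite sobr_filter_join; apply: sobr_filter_sub => X GX AX.
have RX : inter_closure G (residual (sobr_filter F) X).
  case: GX => [[c _ <-]|cpX]; first exact: residual_upper_trace.
  exact: residual_completely_prime.
move=> a [Fa Aa]; rewrite -[a]joinxx.
suff : residual (sobr_filter F) X a by apply.
move: Aa; apply: (sobr_filter_meet RX) => F' AF' b F'b x Fx.
apply: AX; have /sobr_leP := bigmeet_lb (imageP (Order.join F) AF').
apply; rewrite sobr_filter_join; split.
  by apply: (filter_up (sobr_filter_filter F)) Fx; rewrite leUr.
by apply: (filter_up (sobr_filter_filter F')) F'b; rewrite leUl.
Qed.

Lemma sobr_dense (F : S) : F = bigmeet (sobr_incl He @` sobr_filter F).
Proof.
apply/le_anti/andP; split.
  by apply: le_bigmeet => _ [a Fa <-]; apply/sobr_inclP.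
apply/sobr_leP => a Fa; apply/sobr_inclP.
by apply: bigmeet_lb; exists a.
Qed.

Lemma sobr_incl_frame_map : frame_map (sobr_incl He).
Proof.
split=> [A||a b].
- apply/le_anti/andP; split; last first.
    apply: bigjoin_le => _ [a Aa <-]; apply/sobr_inclP.
    exact: (bigjoin_ub Aa).
  apply/sobr_leP; rewrite sobr_filter_bigjoin => b Ab.
  by apply: bigjoin_le => a Aa; apply: (Ab (sobr_incl He a)); exists a.
- apply/le_anti; rewrite lex1 /=.
  apply/sobr_inclP; exact: filter_top (sobr_filter_filter _).
- apply/le_anti; rewrite lexI -andbA; apply/and3P; split.
  + by apply/sobr_inclP; apply: leIl.
  + by apply/sobr_inclP; apply: leIr.
  + apply/sobr_inclP; apply: (filter_meet (sobr_filter_filter _));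
    by apply/sobr_inclP; rewrite ?leIl ?leIr.
Qed.

Lemma sobr_strongly_exact (A : set L) : strongly_exact A ->
  sobr_incl He (bigmeet A) = bigmeet (sobr_incl He @` A).
Proof.
move=> seA; apply/le_anti/andP; split.
  apply: le_bigmeet => _ [a Aa <-]; apply/sobr_inclP.
  exact: bigmeet_lb Aa.
apply/sobr_inclP; apply: (sobr_filter_sub (A := [set bigmeet A])) (erefl _).
move=> X GX AX _ ->.
have {}AX : A `<=` X.
  move=> a Aa; apply: AX; apply/sobr_inclP.
  by apply: bigmeet_lb; exists a.
case: GX => [[c _ cX]|cpX]; last exact: completely_prime_strongly_exact.
rewrite -cX /upper_trace /= (raney_strongly_exact He seA).
by apply: le_bigmeet => _ [a /AX + <-]; rewrite -cX.
Qed.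

Lemma sobr_raney : raney (sobr_incl He).
Proof.
split.
- exact: raney_frame He.
- exact: sobr_coframe.
- move=> a b; apply/sobr_inclP/idP; exact.
- by move=> F; exists (sobr_filter F); apply: sobr_dense.
- exact: sobr_incl_frame_map.
- exact: sobr_strongly_exact.
Qed.

Lemma sobr_sober : sober (sobr_incl He).
Proof.
move=> F a cpF /sobr_inclP; apply: sobr_filter_meet.
  by apply: inter_closure_generator; right.
by move=> _ [b Fb <-] x bx; apply: (filter_up cpF.1 (bx : b <= x) Fb).
Qed.

(** * The map to the original extension *)

Lemma sobr_map_incl a : sobr_map (sobr_incl He a) = e a.
Proof.
apply/le_anti/andP; split; first by apply: bigmeet_lb; exists a => //; apply: lexx.
by apply: le_bigmeet => _ [b ab <-]; rewrite (raney_mono He).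
Qed.

Lemma sobr_map_coframe_map : coframe_map (@sobr_map _ _ L C e).
Proof.
have fe := raney_frame_map He; split=> [A||F F'].
- apply/le_anti/andP; split.
    apply: le_bigmeet => _ [F AF <-]; apply: le_bigmeet => _ [a Fa <-].
    apply: bigmeet_lb; exists a => //.
    by have /sobr_leP := bigmeet_lb AF; apply.
  (* The upper trace of [c] is closed and contains every filter of [A]. *)
  apply: le_bigmeet => _ [a + <-]; set c := bigmeet (_ @` A).
  suff: sobr_filter (bigmeet A) `<=` upper_trace e c by apply.
  apply: sobr_filter_meet.
    by apply: inter_closure_generator; left; exists c.
  move=> F AF b Fb; apply: (@le_trans _ _ (sobr_map F)).
    by apply: bigmeet_lb; exists F.
  by apply: bigmeet_lb; exists b.
- apply/le_anti; rewrite le0x andbT -(frame_map_bot fe).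
  by apply: bigmeet_lb; exists \bot.
- rewrite /sobr_map (coframe_join_bigmeets _ _ (raney_coframe He)).
  rewrite sobr_filter_join; congr bigmeet; apply/seteqP; split=> c.
    move=> [a [Fa F'a] <-]; exists (e a), (e a).
    by split; [exists a|exists a|rewrite joinxx].
  move=> [_ [_ [[a Fa <-] [b F'b <-] ->]]].
  exists (a `|` b); last exact: frame_map_joinU.
  by split; [apply: (filter_up (sobr_filter_filter F)) Fa; rewrite leUl
            |apply: (filter_up (sobr_filter_filter F')) F'b; rewrite leUr].
Qed.

Lemma sobr_map_morphism : raney_morphism (sobr_incl He) e (@sobr_map _ _ L C e).
Proof.
split; first exact: sobr_map_coframe_map.
exists id; last exact: sobr_map_incl.
by split=> // A; rewrite image_id.
Qed.

(** * Lifting morphisms from sober extensions *)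

Section Lifting.
Context (dM dD : Order.disp_t).
Context (M : completeLatticeType dM) (D : completeLatticeType dD) (j : M -> D).
Hypotheses (Hj : raney j) (sj : sober j).
Context (f : D -> C) (g : M -> L).
Hypotheses (Hf : coframe_map f) (Hg : frame_map g).
Hypothesis fg : forall m, f (j m) = e (g m).

Lemma coframe_map_le x y : x <= y -> f x <= f y.
Proof. by move=> /join_idPl <-; rewrite (coframe_map_join Hf) leUr. Qed.

(** For the upper trace of [c], the witness is the value at [c] of the left
    adjoint of [f]. For a completely prime [X], it is the meet of the preimage,
    and sobriety of [j] says that the preimage contains all of the upper trace
    of that meet. *)
Lemma generator_preimage X : G X -> exists d, g @^-1` X = upper_trace j d.
Proof.
case=> [[c _ <-]|cpX].
  exists (bigmeet [set d | c <= f d]); apply/seteqP; split=> m.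
    by rewrite /preimage /upper_trace /= -fg => cm; apply: bigmeet_lb.
  rewrite /preimage /upper_trace /= -fg => /coframe_map_le; apply: le_trans.
  rewrite (coframe_map_meet Hf).
  by apply: le_bigmeet => _ [d cd <-].
exists (bigmeet (j @` (g @^-1` X))); apply/seteqP; split=> m.
  by move=> Xm; apply: bigmeet_lb; exists m.
by apply: sj; apply: completely_prime_preimage.
Qed.

Definition sobr_lift (d : D) : S :=
  bigmeet ((sobr_incl He \o g) @` upper_trace j d).

Lemma sobr_lift_le d d' : d <= d' -> sobr_lift d <= sobr_lift d'.
Proof.
move=> dd'; apply: le_bigmeet => _ [m dm <-].
by apply: bigmeet_lb; exists m => //; apply: le_trans dd' dm.
Qed.

Lemma sobr_lift_incl m : sobr_lift (j m) = sobr_incl He (g m).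
Proof.
apply/le_anti/andP; split.
  by apply: bigmeet_lb; exists m => //; apply: lexx.
apply: le_bigmeet => _ [m' mm' <-] /=.
apply: (frame_map_le sobr_incl_frame_map); apply: (frame_map_le Hg).
by rewrite -(raney_mono Hj).
Qed.

Lemma sobr_lift_coframe_map : coframe_map sobr_lift.
Proof.
split=> [A||d d'].
- apply/le_anti/andP; split.
    by apply: le_bigmeet => _ [d Ad <-]; apply: sobr_lift_le; apply: bigmeet_lb.
  apply: le_bigmeet => _ [m Am <-] /=; apply/sobr_inclP.
  apply: (sobr_filter_sub (A := [set g m])) (erefl _) => X GX AX _ ->.
  (* [X] contains every [g @` upper_trace j d], that is, [h <= d] for all [d] in
     [A]; so [h] is below their meet. *)
  have [h hE] := generator_preimage GX.
  suff: (g @^-1` X) m by [].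
  rewrite hE; apply: le_trans Am; apply: le_bigmeet => d Ad.
  rewrite -(bigmeet_upper_trace Hj d); apply: le_bigmeet => _ [m' dm' <-].
  suff: upper_trace j h m' by [].
  rewrite -hE; apply: AX; apply/sobr_inclP.
  apply: (@le_trans _ _ (sobr_lift d)); first by apply: bigmeet_lb; exists d.
  by apply: bigmeet_lb; exists m'.
- apply/le_anti; rewrite le0x andbT.
  rewrite -(frame_map_bot sobr_incl_frame_map) -(frame_map_bot Hg).
  by apply: bigmeet_lb; exists \bot => //; rewrite /upper_trace /= le0x.
- apply/le_anti; rewrite leUx !sobr_lift_le ?leUl ?leUr // !andbT.
  rewrite (coframe_join_bigmeets _ _ sobr_coframe).
  apply: le_bigmeet => _ [_ [_ [[m dm <-] [m' dm' <-] ->]]] /=.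
  rewrite -(frame_map_joinU sobr_incl_frame_map) -(frame_map_joinU Hg).
  apply: bigmeet_lb; exists (m `|` m') => //.
  rewrite /upper_trace /= (frame_map_joinU (raney_frame_map Hj)).
  exact: leU2.
Qed.

Lemma sobr_liftK : @sobr_map _ _ L C e \o sobr_lift = f.
Proof.
apply/funext => d /=.
rewrite (coframe_map_meet sobr_map_coframe_map) image_comp.
rewrite -{2}(bigmeet_upper_trace Hj d) (coframe_map_meet Hf) image_comp.
congr bigmeet; apply: eq_imagel => m _ /=.
by rewrite sobr_map_incl fg.
Qed.

End Lifting.

End Sobrification.

Theorem theorem4p2 (dL dC : Order.disp_t) (L : completeLatticeType dL)
  (C : completeLatticeType dC) (e : L -> C) (He : raney e) :
  sobrification e (sobr_incl He) (@sobr_map dL dC L C e).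
Proof.
split.
- exact: sobr_raney.
- exact: sobr_sober.
- exact: sobr_map_morphism.
move=> dM dD M D j f Hj sj [Hf [g Hg fg]].
exists (sobr_lift He j g); last exact: sobr_liftK.
split; first exact: sobr_lift_coframe_map Hg fg.
by exists g => // m; apply: sobr_lift_incl.
Qed.
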